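(* Let $d,k\in\mathbb{N}$, let $\Gamma$ be an abelian group and suppose $\pi:\mathbb{Z}^d\to\Gamma$ is a surjective group homomorphism. If there exists an aperiodic $k$-tuple for $\Gamma$, then there exists an aperiodic $k$-tuple for $\mathbb{Z}^d$.
   Context: $\mathbb{N}$ denotes the positive integers. For an abelian group $\Gamma$ and subsets $A,B,C\subseteq\Gamma$, $A\oplus B=C$ means that $A+B=C$ and every $c\in C$ has a unique representation $c=a+b$ with $a\in A$, $b\in B$. $\biguplus$ denotes the union of pairwise disjoint sets. For finite subsets $F_1,\ldots,F_k\subset\Gamma$ and $E\subseteq\Gamma$, $$\mathit{Tile}(F_1,\ldots,F_k;E)=\Big\{(A_1,\ldots,A_k)\in(2^\Gamma)^k:\ \biguplus_{j=1}^k(F_j\oplus A_j)=E\Big\},$$ where $2^\Gamma$ is the set of all subsets of $\Gamma$. A $k$-tuple $(A_1,\ldots,A_k)\in(2^\Gamma)^k$ is periodic if there exists a finite index subgroup $\Gamma_0<\Gamma$ that fixes every $A_j$, i.e. $A_j+\gamma=A_j$ for all $\gamma\in\Gamma_0$ and $1\le j\le k$. A $k$-tuple $(F_1,\ldots,F_k)$ of finite subsets of $\Gamma$ is aperiodic (an aperiodic $k$-tuple for $\Gamma$) if $\mathit{Tile}(F_1,\ldots,F_k;\Gamma)$ is non-empty but does not contain a periodic $k$-tuple. *)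

(* Defs.v *)
From HB Require Import structures.
From mathcomp Require Import all_boot all_order all_algebra.
From mathcomp Require Import boolp classical_sets functions cardinality.

Set Implicit Arguments.
Unset Strict Implicit.
Unset Printing Implicit Defensive.

Import GRing.Theory.
Local Open Scope classical_set_scope.
Local Open Scope ring_scope.

Section Tilings.
Variable G : zmodType.

Definition sumset (A B : set G) : set G := [set a + b | a in A & b in B].

Definition direct_sum (A B C : set G) : Prop :=
  sumset A B = C /\
  forall c, C c -> exists! p : G * G, [/\ A p.1, B p.2 & c = p.1 + p.2].

(* In the disjoint union of the [F j (+) A j], each sum must itself be direct. *)
Definition Tile (k : nat) (F : 'I_k -> set G) (E : set G) :
    set ('I_k -> set G) :=
  [set A | [/\ forall j, direct_sum (F j) (A j) (sumset (F j) (A j)),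
               trivIset [set: 'I_k] (fun j => sumset (F j) (A j)) &
               \bigcup_j sumset (F j) (A j) = E]].

Definition translate (A : set G) (g : G) : set G := [set a + g | a in A].

Definition subgroup (H : set G) : Prop := zmod_closed (mem H).

Definition finite_index (H : set G) : Prop :=
  finite_set [set translate H g | g in [set: G]].

Definition periodic (k : nat) (A : 'I_k -> set G) : Prop :=
  exists H : set G, [/\ subgroup H, finite_index H &
    forall g, H g -> forall j, translate (A j) g = A j].

Definition aperiodic (k : nat) (F : 'I_k -> set G) : Prop :=
  [/\ forall j, finite_set (F j),
      Tile F [set: G] !=set0 &
      ~ exists A, Tile F [set: G] A /\ periodic A].

End Tilings.

(* Main.v *)
Require Import Defs.
From HB Require Import structures.
From mathcomp Require Import all_boot all_order all_algebra.
From mathcomp Require Import boolp classical_sets functions cardinality.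
From mathcomp Require Import zify.

Set Implicit Arguments.
Unset Strict Implicit.
Unset Printing Implicit Defensive.

Import GRing.Theory.
Local Open Scope classical_set_scope.
Local Open Scope ring_scope.

(** Fix a section [sigma] of [pi] and stretch one coordinate of Z^d by a large
    factor N: every point is [cell y i = phi y + i e] for a unique y in Z^d and
    a unique i < N, so Z^d is cut into segments of length N parallel to e, one
    for each y.  Replacing each f in [F j] by the segment at [sigma f] turns
    [F j] into a finite subset of Z^d, [block j], and a tiling (A_j) of Gamma
    into the tiling (phi (pi^-1 A_j)) of Z^d.

    The converse works for those tilings by blocks that are invariant under
    [phi (ker pi)] ([tiling_descent]).  The segments of such a tiling need not
    lie in the standard position: on different lines parallel to e they may have
    different residues modulo N.  But all segments of one block have the same
    residue, so the residue can simply be forgotten, which is what [descent]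
    does.

    To force the invariance, choose finitely many nonzero generators v_l of the
    monoid [ker pi] and one segment in each nonempty block.  In that segment cut
    out, for each l, a short interval (a notch), and put it back translated by
    [phi v_l].  This is [tile j].  A tuple which is invariant under
    [phi (ker pi)] cannot tell tiles from blocks ([tiling_shear]), so it
    suffices that every tiling by the tiles is invariant.  A notch of a placed
    tile lies between two points of that tile, hence it is filled by whole runs
    (maximal intervals parallel to e) of other placed tiles.  A run either is
    longer than any notch, or is one of the translated intervals.  The notch widths
    are distinct and lie in [K, 2K), so two runs do not fit into one notch, and a
    single run fills it only if it comes from the same pair (j, l).  Thus if a
    tile j is placed at a, a tile j is also placed at [a - phi v_l]
    ([notch_forced]); since the v_l generate [ker pi] as a monoid, invariance
    follows.

    Every tiling by the tiles therefore descends to a tiling of Gamma, and the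
    descent of a periodic tiling is periodic ([descent_periodic]). *)

(** * Tilings by unique representation *)

Definition tiling (G : zmodType) (k : nat) (F A : 'I_k -> set G) : Prop :=
  (forall x, exists j f a, [/\ F j f, A j a & x = f + a]) /\
  (forall j f a j' f' a', F j f -> A j a -> F j' f' -> A j' a' ->
     f + a = f' + a' -> j = j' /\ a = a').

Lemma TileP (G : zmodType) (k : nat) (F A : 'I_k -> set G) :
  Tile F [set: G] A <-> tiling F A.
Proof.
split=> [[dir dis cov]|[ex uniq]].
- split=> [x|j f a j' f' a' Ff Aa Ff' Aa' E].
    have [j _ [f Ff [a Aa <-]]] : (\bigcup_j sumset (F j) (A j)) x.
      by rewrite cov.
    by exists j, f, a.
  have S : sumset (F j) (A j) (f + a) by exists f => //; exists a.
  have S' : sumset (F j') (A j') (f + a).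
    by rewrite E; exists f' => //; exists a'.
  have ej : j = j' by apply: dis => //; exists (f + a).
  split=> //; subst j'.
  have [_ /(_ _ S) [p [_ U]]] := dir j.
  have U1 := U (f, a) (And3 Ff Aa (erefl _)).
  have U2 := U (f', a') (And3 Ff' Aa' E).
  by have := etrans (esym U1) U2; case.
- split=> [j||].
  + split=> // c [f Ff [a Aa <-]]; exists (f, a).
    split=> // -[f' a'] /= [Ff' Aa' E].
    have [_ ea] := uniq _ _ _ _ _ _ Ff Aa Ff' Aa' E; subst a'.
    by move/addIr: E => ->.
  + move=> j j' _ _ [x [[f Ff [a Aa <-]] [f' Ff' [a' Aa' E]]]].
    by have [] := uniq _ _ _ _ _ _ Ff Aa Ff' Aa' (esym E).
  + apply/seteqP; split=> // x _; have [j [f [a [Ff Aa ->]]]] := ex x.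
    by exists j => //; exists f => //; exists a.
Qed.

(** * Finite generation of subgroups of Z^d *)

(** The second clause is an induction principle rather than a formula for the
    elements, because generators are only ever used to propagate an invariance.
    Only the addition of generators is allowed there, so one-sided steps
    suffice.
    A zero generator would displace nothing and leave no trace in a tile. *)
Definition monoid_generated (G : zmodType) (L : set G) (s : seq G) : Prop :=
  (forall v, v \in s -> L v /\ v <> 0) /\
  (forall P : set G, P 0 -> (forall x v, v \in s -> P x -> P (x + v)) ->
     L `<=` P).

Lemma subgroupP (G : zmodType) (L : set G) :
  subgroup L <-> L 0 /\ forall x y, L x -> L y -> L (x - y).
Proof.
split=> [[L0 LB]|[L0 LB]]; split.
- by move: L0; rewrite inE.
- by move=> x y Lx Ly; have := LB x y; rewrite !inE; apply.
- by rewrite inE.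
- by move=> x y; rewrite !inE; apply: LB.
Qed.

(** Euclidean division: if u in L has the smallest positive value of c, then
    subtracting a multiple of u from an element of L gives an element of the
    kernel of c.  Adding both u and -u to the list keeps it generating as a
    monoid. *)
Lemma generated_from_kernel (G : zmodType) (c : {additive G -> int})
    (L : set G) :
  subgroup L ->
  (exists s, monoid_generated (L `&` [set x | c x = 0]) s) ->
  exists s, monoid_generated L s.
Proof.
move=> /subgroupP[L0 LB] [s [sL gen]].
have LN x : L x -> L (- x) by move=> Lx; rewrite -sub0r; apply: LB.
have LD x y : L x -> L y -> L (x + y).
  by move=> Lx Ly; rewrite -[y]opprK; apply: LB => //; apply: LN.
have [[x [Lx cx]]|triv] := pselect (exists x, L x /\ c x <> 0); last first.
  exists s; split=> [v /sL[[]]//|P P0 PS x Lx].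
  apply: (gen P) => //; split=> //=.
  by apply: contrapT => cx; apply: triv; exists x.
pose Q m := `[< (0 < m)%N /\ exists u, L u /\ c u = m%:Z >].
have exQ : exists m, Q m.
  exists `|c x|%N; apply/asboolP; split; first by lia.
  have [ge0|lt0] : 0 <= c x \/ c x < 0 by lia.
    by exists x; split=> //; lia.
  exists (- x); split; first exact: LN.
  by rewrite raddfN; move: (c x) lt0 => *; lia.
case: (ex_minnP exQ) => m /asboolP[m_gt0 [u [Lu cu]]] m_min.
have u_neq0 : u <> 0 by move=> u0; move: cu; rewrite u0 raddf0; lia.
have Lun n : L (u *+ n).
  by elim: n => [|n IH]; rewrite ?mulr0n // mulrS; apply: LD.
have Luz z : L (u *~ z).
  by case: z => n; rewrite ?NegzE ?mulrNz -pmulrn //; apply: LN.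
exists [:: u, - u & s]; split.
  move=> v; rewrite !inE => /orP[/eqP->//|/orP[/eqP->|/sL[[]]//]].
  by split; [exact: LN|move=> /eqP; rewrite oppr_eq0 => /eqP].
move=> P P0 PS y Ly.
pose z := (c y %/ c u)%Z.
have Py' : P (y - u *~ z).
  apply: (gen P) => //.
    by move=> ? w ws; apply: PS; rewrite !inE ws !orbT.
  have Ly' : L (y - u *~ z) by apply: LB.
  split=> //=; apply: contrapT => cy'.
  have cE : c (y - u *~ z) = (c y %% c u)%Z.
    rewrite raddfB raddfMz /= /z {1}(divz_eq (c y) (c u)).
    by rewrite -mulrzr intz mulrC addrC addKr.
  have : (m <= `|c (y - u *~ z)%R|)%N.
    apply: m_min; apply/asboolP; split; first by lia.
    by exists (y - u *~ z); split=> //; rewrite cE cu; lia.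
  by rewrite cE cu; lia.
have PDn n x' : P x' -> P (x' + u *+ n).
  elim: n x' => [|n IH] x' Px'; rewrite ?mulr0n ?addr0 // mulrSr addrA.
  by apply: PS (IH _ Px'); rewrite !inE eqxx.
have PBn n x' : P x' -> P (x' - u *+ n).
  elim: n x' => [|n IH] x' Px'; rewrite ?mulr0n ?subr0 // mulrSr opprD addrA.
  by apply: PS (IH _ Px'); rewrite !inE eqxx orbT.
rewrite -[y](subrK (u *~ z)); case: z Py' => n Py'.
  exact: PDn.
exact: (PBn n.+1).
Qed.

Section Coordinate.
Variables (n : nat) (i : 'I_n).
Definition coordinate (x : 'rV[int]_n) : int := x 0 i.
Lemma coordinate_is_additive : zmod_morphism coordinate.
Proof. by move=> x y; rewrite /coordinate !mxE. Qed.
HB.instance Definition _ :=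
  GRing.isZmodMorphism.Build _ _ coordinate coordinate_is_additive.
End Coordinate.

(** The coordinates are killed one at a time, by applying
    [generated_from_kernel] to the subgroups [Lm m] of the elements whose first
    m coordinates vanish. *)
Lemma lattice_subgroup_generated (n : nat) (L : set 'rV[int]_n) :
  subgroup L -> exists s, monoid_generated L s.
Proof.
move=> subL; have /subgroupP[L0 LB] := subL.
pose Lm m := L `&` [set x | forall i : 'I_n, (i < m)%N -> x 0 i = 0].
have subLm m : subgroup (Lm m).
  apply/subgroupP; split; first by split=> //= i _; rewrite mxE.
  move=> x y [Lx x0] [Ly y0]; split; first exact: LB.
  by move=> i im; rewrite !mxE x0 ?y0 // subrr.
suff /(_ n (leqnn n)) : forall m, (m <= n)%N ->
    exists s, monoid_generated (Lm (n - m)%N) s.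
  have -> // : Lm (n - n)%N = L.
  by apply/seteqP; split=> [x []//|x Lx]; split=> //= i; lia.
elim=> [_|m IH lt_mn].
  exists [::]; split=> // P P0 _ x [_ x0]; suff -> : x = 0 by [].
  by apply/rowP => i; rewrite mxE x0 // subn0 ltn_ord.
have lt_i : (n - m.+1 < n)%N by lia.
apply: (generated_from_kernel (c := coordinate (Ordinal lt_i))) => //.
have [s gen] := IH (ltnW lt_mn); exists s.
suff -> : Lm (n - m.+1)%N `&` [set x | coordinate (Ordinal lt_i) x = 0] =
  Lm (n - m)%N by [].
apply/seteqP; split=> x.
  case=> -[Lx x0] /= xi; split=> //= i im.
  have [ltin|] := ltnP i (n - m.+1); first exact: x0.
  move=> ?; have -> : i = Ordinal lt_i by apply: val_inj => /=; lia.
  exact: xi.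
case=> Lx x0; split; first by split=> //= i im; apply: x0; lia.
by apply: x0 => /=; lia.
Qed.

(** * Shearing a tiling along its symmetries *)

(** If the piece [u j x] of the tile j is moved by a vector under which [A j] is
    invariant, then the pieces arriving from the other copies of the tile
    replace those that left: in [t j x + a] the displacement can be moved from
    the first summand to the second. *)
Lemma tiling_shear (G : zmodType) (k : nat) (X : Type) (I : 'I_k -> set X)
    (u t : 'I_k -> X -> G) (A : 'I_k -> set G) :
  (forall j x x', I j x -> I j x' -> u j x = u j x' -> x = x') ->
  (forall j x a, I j x -> A j a ->
     A j (a + (t j x - u j x)) /\ A j (a - (t j x - u j x))) ->
  tiling (fun j => u j @` I j) A -> tiling (fun j => t j @` I j) A.
Proof.
move=> u_inj stab [ex uniq]; split.
  move=> y; have [j [_ [a [[x Ix <-] Aa ->]]]] := ex y.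
  exists j, (t j x), (a - (t j x - u j x)); split; first by exists x.
    exact: (stab _ _ _ Ix Aa).2.
  by rewrite addrCA opprB [t j x + _]addrC subrK addrC.
move=> j _ a j' _ a' [x Ix <-] Aa [x' Ix' <-] Aa' E.
have rew i z b : t i z + b = u i z + (b + (t i z - u i z)).
  by rewrite addrCA [u i z + _]addrC subrK addrC.
have [|ej ea] := uniq j (u j x) _ j' (u j' x') _ (ex_intro2 _ _ x Ix erefl)
  (stab _ _ _ Ix Aa).1 (ex_intro2 _ _ x' Ix' erefl) (stab _ _ _ Ix' Aa').1.
  by rewrite -!rew.
split=> //; subst j'; have : u j x = u j x'.
  by move: E; rewrite (rew j x) (rew j x') ea => /addIr.
by move=> /u_inj ex'; move: E; rewrite ex' // => /addrI.
Qed.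

(** * Positions and widths of the notches *)

(** The rank of (j, l) makes all widths distinct; adding the number of labels
    puts them in [k r, 2 k r), so that the difference of two widths is smaller
    than every width. *)
Definition notch_width (k r : nat) (j : 'I_k) (l : 'I_r) : nat :=
  (k * r + enum_rank (j, l))%N.
Definition spacing (k r : nat) : nat := (k * r).*2.+1.
Definition notch_start (k r : nat) (l : 'I_r) : nat :=
  (l.*2.+1 * spacing k r)%N.
Definition segment_length (k r : nat) : nat := (r.*2.+1 * spacing k r)%N.
Definition in_notch (k r : nat) (j : 'I_k) (l : 'I_r) (i : nat) : bool :=
  (notch_start k l <= i < notch_start k l + notch_width j l)%N.

Lemma notch_width_bounds (k r : nat) (j : 'I_k) (l : 'I_r) :
  (0 < k * r <= notch_width j l)%N /\
  (notch_width j l < (k * r).*2)%N.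
Proof.
have lt_rank : (enum_rank (j, l) < k * r)%N.
  by apply: leq_trans (ltn_ord _) _; rewrite card_prod !card_ord.
by rewrite /notch_width; lia.
Qed.

Lemma notch_width_inj (k r : nat) (j j' : 'I_k) (l l' : 'I_r) :
  notch_width j l = notch_width j' l' -> j = j' /\ l = l'.
Proof. by move=> /addnI/val_inj/enum_rank_inj[-> ->]. Qed.

Lemma notch_start_bounds (k r : nat) (l : 'I_r) :
  (spacing k r <= notch_start k l)%N /\
  (notch_start k l + (spacing k r).*2 <= segment_length k r)%N.
Proof.
have := ltn_ord l; rewrite /notch_start /segment_length => lr.
split; first exact: leq_pmull.
by rewrite -(mul2n (spacing k r)) -mulnDl leq_pmul2r //; lia.
Qed.

Lemma notches_apart (k r : nat) (l l' : 'I_r) : l <> l' ->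
  (notch_start k l + (spacing k r).*2 <= notch_start k l')%N \/
  (notch_start k l' + (spacing k r).*2 <= notch_start k l)%N.
Proof.
move=> ne; have : val l <> val l' by move/val_inj.
by rewrite /notch_start -(mul2n (spacing k r)) -!mulnDl !leq_pmul2r //=; lia.
Qed.

(** Between the solid interval of length [spacing] before a notch and the one
    after it there is no other notch. *)
Lemma notch_gap (k r : nat) (j : 'I_k) (l l' : 'I_r) (i : nat) :
  (notch_start k l <= i + spacing k r)%N ->
  (i < notch_start k l + (spacing k r).*2)%N ->
  ~~ in_notch j l i -> ~~ in_notch j l' i.
Proof.
have [->//|/eqP/(notches_apart k) apart] := eqVneq l' l.
have [_ ?] := notch_width_bounds j l'; move: apart.
by rewrite /in_notch /spacing; lia.
Qed.

(** * Notched tiles and their forced symmetries *)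

Section Simulation.
Variables (G Gamma : zmodType) (k r : nat).
Variables (pi : {additive G -> Gamma}) (sigma : Gamma -> G).
Implicit Types (j : 'I_k) (l : 'I_r).
Hypothesis sigmaK : cancel sigma pi.
Variable v : 'I_r -> G.
Hypotheses (v_ker : forall l, pi (v l) = 0) (v_neq0 : forall l, v l <> 0).
Hypothesis v_gen : forall P : set G, P 0 ->
  (forall x l, P x -> P (x + v l)) -> forall x, pi x = 0 -> P x.
Variables (F : 'I_k -> set Gamma) (f0 : 'I_k -> Gamma).
Hypothesis f0P : forall j f, F j f -> F j (f0 j).

Local Notation N := (segment_length k r).
Local Notation start := (notch_start k).

Variables (phi : {additive G -> G}) (e : G).
(** The i-th point of the segment attached to y. *)
Definition cell (y : G) (i : nat) : G := phi y + e *+ i.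
Hypothesis cell_ex : forall x, exists y i, (i < N)%N /\ x = cell y i.
Hypothesis cell_inj : forall y y' i i', (i < N)%N -> (i' < N)%N ->
  cell y i = cell y' i' -> y = y' /\ i = i'.

Lemma cellD y z i : cell (y + z) i = cell y i + phi z.
Proof. by rewrite /cell raddfD /= addrAC. Qed.

Lemma cellM y i n : cell y i + e *+ n = cell y (i + n).
Proof. by rewrite /cell -addrA -mulrnDr. Qed.

Lemma cell_pred y i : (0 < i)%N -> cell y i - e = cell y i.-1.
Proof. by case: i => // i _; rewrite /cell mulrSr addrA addrK. Qed.

(** The displacement, before applying phi, of the i-th point of the
    distinguished segment of tile j. *)
Definition profile (j : 'I_k) (i : nat) : G :=
  if [pick l | in_notch j l i] is Some l then v l else 0.

Lemma profile_notch j l i : in_notch j l i -> profile j i = v l.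
Proof.
rewrite /profile; case: pickP => [l' il' il|/(_ l)->//].
have [->//|/eqP/(notches_apart k)] := eqVneq l' l; move: il il'.
have [_ ?] := notch_width_bounds j l; have [_ ?] := notch_width_bounds j l'.
by rewrite /in_notch /spacing; lia.
Qed.

Lemma profile_solid j i : (forall l, ~~ in_notch j l i) -> profile j i = 0.
Proof. by rewrite /profile; case: pickP => // l il /(_ l); rewrite il. Qed.

Lemma profile_gap j l i : (start l <= i + spacing k r)%N ->
  (i < start l + (spacing k r).*2)%N -> ~~ in_notch j l i -> profile j i = 0.
Proof.
by move=> ? ? ?; apply: profile_solid => l'; apply: (notch_gap (l := l)).
Qed.

Definition shift (j : 'I_k) (f : Gamma) (i : nat) : G :=
  if f == f0 j then profile j i else 0.

Lemma shift_ker j f i : pi (shift j f i) = 0.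
Proof.
by rewrite /shift /profile; case: ifP => _; rewrite ?raddf0 //;
  case: pickP => [l _|_]; rewrite ?raddf0.
Qed.

(** A point of a block is addressed by the element of [F j] and the offset in
    the segment, so that block and tile are two images of one index set. *)
Definition slots (j : 'I_k) : set (Gamma * nat) :=
  [set x | F j x.1 /\ (x.2 < N)%N].
Definition block_at (j : 'I_k) (x : Gamma * nat) : G := cell (sigma x.1) x.2.
Definition tile_at (j : 'I_k) (x : Gamma * nat) : G :=
  cell (sigma x.1 + shift j x.1 x.2) x.2.
Definition block j : set G := block_at j @` slots j.
Definition tile j : set G := tile_at j @` slots j.

(** Since displacements lie in [ker pi], the only f in [F j] that can contribute
    a point to the segment of y is [pi y]. *)
Lemma tile_cell j y i : (i < N)%N ->
  tile j (cell y i) <-> F j (pi y) /\ y = sigma (pi y) + shift j (pi y) i.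
Proof.
move=> iN; split=> [[[f n] [/= Ff nN]] /(cell_inj nN iN) [<- <-]|[Fy yE]].
  by rewrite raddfD /= sigmaK shift_ker addr0.
by exists (pi y, i) => //; rewrite /tile_at /= -yE.
Qed.

Lemma block_at_inj j x x' : slots j x -> slots j x' ->
  block_at j x = block_at j x' -> x = x'.
Proof.
case: x x' => [f i] [f' i'] [/= _ iN] [/= _ iN'] /(cell_inj iN iN')[/=].
by move=> /(can_inj sigmaK) -> ->.
Qed.

Lemma tile_at_inj j x x' : slots j x -> slots j x' ->
  tile_at j x = tile_at j x' -> x = x'.
Proof.
case: x x' => [f i] [f' i'] [/= _ iN] [/= _ iN'] /(cell_inj iN iN')[/=].
move=> /(congr1 pi); rewrite !raddfD /= !sigmaK !shift_ker !addr0.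
by move=> -> ->.
Qed.

(** Where a run of a tile begins, one sees either a long solid stretch (the
    start of a segment or the part after a notch), or exactly one displaced
    notch. *)
Lemma run_start j x : tile j x -> ~ tile j (x - e) ->
  (forall n, (n < spacing k r)%N -> tile j (x + e *+ n)) \/
  exists l, [/\ x = cell (sigma (f0 j) + v l) (start l),
    forall n, (n < notch_width j l)%N -> tile j (x + e *+ n) &
    ~ tile j (x + e *+ notch_width j l)].
Proof.
have [y [i [iN ->]]] := cell_ex x; move=> /(tile_cell j y iN)[Fy yE] Tpred.
have prev : (0 < i)%N -> y <> sigma (pi y) + shift j (pi y) i.-1.
  move=> i_gt0 E; apply: Tpred; rewrite cell_pred //.
  by apply/tile_cell => //; lia.
have run n : (i + n < N)%N -> shift j (pi y) (i + n) = shift j (pi y) i ->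
    tile j (cell y i + e *+ n).
  by move=> inN sE; rewrite cellM; apply/tile_cell => //; rewrite sE.
have [f0y|f0y] := eqVneq (pi y) (f0 j); last first.
  have s0 n : shift j (pi y) n = 0 by rewrite /shift (negbTE f0y).
  have i0 : i = 0%N.
    by case: i {yE run iN Tpred} prev yE => // i /(_ isT); rewrite !s0 => H /H.
  left=> n nD; apply: run; rewrite ?s0 // i0 add0n.
  by apply: leq_trans nD _; rewrite /segment_length; nia.
have sE n : shift j (f0 j) n = profile j n by rewrite /shift eqxx.
rewrite f0y in prev yE run; rewrite sE in yE.
have [[l il]|solid] := pselect (exists l, in_notch j l i).
  have [w_gt0 w_lt] := notch_width_bounds j l.
  have [p_gt pN] := notch_start_bounds k l.
  right; exists l; rewrite (profile_notch il) in yE.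
  have iE : i = start l.
    apply: contrapT => ne; have : (0 < i)%N by move: il; rewrite /in_notch; lia.
    move=> /[dup] i_gt0 /prev; rewrite sE (profile_notch (l := l)) //.
    by move: il; rewrite /in_notch; lia.
  split; first by rewrite -yE iE.
    move=> n nw; have inl : in_notch j l (i + n) by rewrite /in_notch iE; lia.
    apply: run; first by move: inl; rewrite /in_notch /spacing in pN *; lia.
    by rewrite !sE !(profile_notch (l := l)).
  rewrite cellM => /tile_cell[]; first by rewrite iE /spacing in pN *; lia.
  have gap : profile j (i + notch_width j l) = 0.
    by apply: (profile_gap (l := l)); rewrite ?/in_notch iE /spacing; lia.
  rewrite f0y sE gap => _ E; apply: (v_neq0 (l := l)).
  by move: E; rewrite yE => /addrI.
have notin l : ~~ in_notch j l i by apply/negP => il; apply: solid; exists l.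
left=> n nD.
suff [inN solid_n] : (i + n < N)%N /\ forall l, ~~ in_notch j l (i + n).
  by apply: run => //; rewrite !sE !profile_solid.
have [i0|i_gt0] := posnP i.
  rewrite i0 add0n; split.
    by apply: leq_trans nD _; rewrite /segment_length; nia.
  by move=> l; have [] := notch_start_bounds k l; rewrite /in_notch; lia.
have [[l il]|solid'] := pselect (exists l, in_notch j l i.-1); last first.
  exfalso; apply: (prev i_gt0); rewrite {1}yE sE !profile_solid // => l.
  by apply/negP => il; apply: solid'; exists l.
have [_ w_lt] := notch_width_bounds j l.
have [_ pN] := notch_start_bounds k l.
have iE : i = (start l + notch_width j l)%N.
  by have := notin l; move: il; rewrite /in_notch; lia.
split; first by rewrite iE /spacing in nD pN *; lia.
by move=> l'; apply: (notch_gap (l := l));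
  rewrite ?/in_notch iE /spacing in nD *; lia.
Qed.

(** Let h be the first point of the notch.  The tile, placed at b, that covers h
    starts a run there, because the point before h belongs to the tile at a.
    The run does not pass the end of the notch, so it is a displaced notch of
    some label.  If it were too short, the rest of the notch would be shorter
    than any run; so the widths agree, and they determine the label. *)
Lemma notch_forced (A : 'I_k -> set G) j f a l :
  tiling tile A -> F j f -> A j a -> A j (a - phi (v l)).
Proof.
move=> [ex uniq] /f0P Ff Aa.
have [K_gt0 w_lt] := notch_width_bounds j l.
have [p_gt pN] := notch_start_bounds k l.
pose covers i b x := A i b /\ tile i (x - b).
have cov x : exists i b, covers i b x.
  have [i [t [b [Tt Ab ->]]]] := ex x.
  by exists i, b; split=> //; rewrite addrK.
have cov_uniq i b i' b' x : covers i b x -> covers i' b' x -> i = i' /\ b = b'.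
  move=> [Ab Tb] [Ab' Tb']; apply: uniq Tb Ab Tb' Ab' _.
  by rewrite !subrK.
pose h := a + cell (sigma (f0 j)) (start l).
have pif0 : pi (sigma (f0 j)) = f0 j by rewrite sigmaK.
have hE n : h + e *+ n - a = cell (sigma (f0 j)) (start l + n).
  by rewrite /h addrAC [a + _]addrC addrK cellM.
have sE n : shift j (pi (sigma (f0 j))) n = profile j n.
  by rewrite /shift pif0 eqxx.
have before : covers j a (h - e).
  split=> //; rewrite /h addrAC [a + _]addrC addrK cell_pred; last first.
    by rewrite /spacing in p_gt; lia.
  apply/tile_cell; first by rewrite /spacing in p_gt pN *; lia.
  rewrite sE (profile_gap (l := l)) ?addr0 ?pif0 //;
    by rewrite ?/in_notch /spacing in p_gt *; lia.
have after : covers j a (h + e *+ notch_width j l).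
  split=> //; rewrite hE; apply/tile_cell.
    by rewrite /spacing in pN *; lia.
  rewrite sE (profile_gap (l := l)) ?addr0 ?pif0 //;
    by rewrite ?/in_notch /spacing; lia.
have inside n : (n < notch_width j l)%N -> ~ covers j a (h + e *+ n).
  move=> nw [_]; rewrite hE => /tile_cell[].
    by rewrite /spacing in pN *; lia.
  rewrite sE (profile_notch (l := l)); last by rewrite /in_notch; lia.
  move=> _ E; apply: (v_neq0 (l := l)); apply: (addrI (sigma (f0 j))).
  by rewrite addr0 {2}E pif0.
have [i [b hb]] := cov h.
have shiftB c n : h + e *+ n - c = h - c + e *+ n by rewrite addrAC.
have stop i' b' n : (n < notch_width j l)%N -> covers i' b' (h + e *+ n) ->
    ~ covers i' b' (h + e *+ notch_width j l).
  move=> nw /[swap] /cov_uniq/(_ after)[-> ->]; exact: inside.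
have w_gt0 : (0 < notch_width j l)%N by lia.
have [Ab Tb] := hb.
have Tpred : ~ tile i (h - b - e).
  move=> T; have /cov_uniq/(_ before)[ei eb] : covers i b (h - e).
    by split=> //; rewrite addrAC.
  by subst i b; apply: (inside 0%N); rewrite ?mulr0n ?addr0.
(* A run longer than the notch would cover the point after it, which belongs
   to the tile at a. *)
have [solid|[l' [hE' run run_end]]] := run_start Tb Tpred.
  exfalso; apply: (stop i b 0%N) => //; first by rewrite mulr0n addr0.
  by split=> //; rewrite shiftB; apply: solid; rewrite /spacing; lia.
have [K_gt0' w_lt'] := notch_width_bounds i l'.
(* A run that is too short leaves a gap of length less than k r; one that is too
   long covers the point after the notch. *)
have [lt_w|lt_w|eq_w] := ltngtP (notch_width i l') (notch_width j l).
- exfalso; have [i' [b' hb']] := cov (h + e *+ notch_width i l').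
  have [Ab' Tb'] := hb'.
  have Tpred' : ~ tile i' (h + e *+ notch_width i l' - b' - e).
    have [m mE] : exists m, notch_width i l' = m.+1.
      by exists (notch_width i l').-1; lia.
    rewrite mE mulrSr addrA [X in tile _ X]addrAC addrK => T.
    have [||ei eb] := cov_uniq i' b' i b (h + e *+ m); first by split.
      by split=> //; rewrite shiftB; apply: run; lia.
    by subst i' b'; apply: run_end; rewrite -shiftB.
  have long : forall n, (n < k * r)%N ->
      tile i' (h + e *+ notch_width i l' - b' + e *+ n).
    have [solid|[l'' [_ run' _]]] := run_start Tb' Tpred'.
      by move=> n nK; apply: solid; rewrite /spacing; lia.
    have [? _] := notch_width_bounds i' l''.
    by move=> n nK; apply: run'; lia.
  apply: (stop i' b' _ lt_w) => //; split=> //.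
  have := long (notch_width j l - notch_width i l')%N.
  rewrite !shiftB -addrA -mulrnDr subnKC; last exact: ltnW.
  by apply; lia.
- exfalso; apply: (stop i b 0%N) => //; first by rewrite mulr0n addr0.
  by split=> //; rewrite shiftB; apply: run.
- have [ei el] := notch_width_inj eq_w; subst i l'.
  suff -> : a - phi (v l) = b by [].
  have -> : b = h - (h - b) by rewrite opprB addrC subrK.
  by rewrite hE' cellD /h opprD addrA addrK.
Qed.

(** * Passing between tilings of the group and of its quotient *)

(** The condition is void for an empty [F j]: then the tile j is empty too, and
    [A j] is arbitrary in every tiling. *)
Definition kernel_invariant (A : 'I_k -> set G) : Prop :=
  forall j f, F j f -> forall a z, pi z = 0 -> A j a -> A j (a + phi z).

Lemma tiling_kernel_invariant A : tiling tile A -> kernel_invariant A.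
Proof.
move=> tA j f Ff a z z0 Aa; rewrite -[z]opprK raddfN /=.
have {z0} : pi (- z) = 0 by rewrite raddfN /= z0 oppr0.
move: (- z) => {}z z0; move: z z0 a Aa.
apply: v_gen => [|x l IH] a Aa; first by rewrite raddf0 subr0.
by rewrite raddfD /= opprD addrA; apply: notch_forced tA Ff (IH _ Aa).
Qed.

Lemma tile_at_block_at j x : tile_at j x - block_at j x = phi (shift j x.1 x.2).
Proof. by rewrite /tile_at /block_at cellD addrAC subrr add0r. Qed.

Lemma tiling_tile_block A : kernel_invariant A ->
  tiling tile A <-> tiling block A.
Proof.
move=> inv.
have stab j x a : slots j x -> A j a ->
    A j (a + phi (shift j x.1 x.2)) /\ A j (a - phi (shift j x.1 x.2)).
  case=> Fx _ Aa; split; first by apply: inv Fx _ _ _ Aa; exact: shift_ker.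
  rewrite -raddfN; apply: inv Fx _ _ _ Aa.
  by rewrite raddfN /= shift_ker oppr0.
split; apply: tiling_shear.
- exact: tile_at_inj.
- move=> j x a Ix Aa; rewrite -opprB tile_at_block_at opprK.
  by have [] := stab _ _ _ Ix Aa.
- exact: block_at_inj.
- by move=> j x a Ix Aa; rewrite tile_at_block_at; exact: stab.
Qed.

Definition lift (A : 'I_k -> set Gamma) (j : 'I_k) : set G :=
  [set phi y | y in [set y | A j (pi y)]].

Lemma lift_kernel_invariant A : kernel_invariant (lift A).
Proof.
move=> j f _ _ z z0 [y Ay <-]; exists (y + z); last by rewrite raddfD.
by rewrite /= raddfD /= z0 addr0.
Qed.

Lemma tiling_lift A : tiling F A -> tiling tile (lift A).
Proof.
move=> [ex uniq]; apply/tiling_tile_block; first exact: lift_kernel_invariant.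
split=> [x|j _ _ j' _ _ [[f i] [/= Ff iN] <-] [y Ay <-]
  [[f' i'] [/= Ff' iN'] <-] [y' Ay' <-]].
  have [y [i [iN ->]]] := cell_ex x; have [j [f [a [Ff Aa yE]]]] := ex (pi y).
  exists j, (cell (sigma f) i), (phi (y - sigma f)); split.
  - by exists (f, i).
  - by exists (y - sigma f) => //=; rewrite raddfB /= sigmaK yE addrC addKr.
  - by rewrite -cellD addrC subrK.
rewrite -!cellD /= => /(cell_inj iN iN')[E _].
have fE : f + pi y = f' + pi y'.
  by have := congr1 pi E; rewrite !raddfD /= !sigmaK.
have [ej ea] := uniq _ _ _ _ _ _ Ff Ay Ff' Ay' fE; split=> //.
move: fE; rewrite ea => /addIr ef; move: E; rewrite ef.
by move=> /addrI ->.
Qed.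

(** The offset i is forgotten: all segments of one placed block start at the
    same offset, but this offset depends on the placement. *)
Definition descent (A : 'I_k -> set G) (j : 'I_k) : set Gamma :=
  [set g | exists y i, [/\ (i < N)%N, A j (cell y i) & g = pi y]].

Lemma cell_add y y' i i' : cell y i + cell y' i' = cell (y + y') (i + i').
Proof. by rewrite /cell raddfD mulrnDr addrACA. Qed.

(** Existence: take the last point [cell (sigma g) N.-1].  The segment of the
    tiling that covers it starts less than N steps before it, hence at some
    [cell (sigma g) i].  Uniqueness: two covers of one element of Gamma can be
    moved by [phi (ker pi)] so that they contain segments starting at [cell y i]
    and [cell y i'] for the same y; these overlap. *)
Lemma tiling_descent A : kernel_invariant A -> tiling block A ->
  tiling F (descent A).
Proof.
move=> inv [ex uniq].
have aligned j f y i j' f' y' i' : F j f -> (i < N)%N -> A j (cell y i) ->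
    F j' f' -> (i' < N)%N -> A j' (cell y' i') ->
    f + pi y = f' + pi y' -> (i <= i')%N -> j = j' /\ pi y = pi y'.
  move=> Ff iN Ay Ff' iN' Ay' E le_i.
  (* After moving the second placement by phi z the two segments start at
     [cell (sigma f + y)] with the offsets i and i'; as i <= i' < N, both
     contain the point with offset i'. *)
  pose z := sigma f + y - (sigma f' + y').
  have z0 : pi z = 0 by rewrite raddfB /= !raddfD /= !sigmaK E -opprD subrr.
  have Az : A j' (cell (y' + z) i') by rewrite cellD; apply: inv Ff' _ _ z0 Ay'.
  have [||//|ej /(cell_inj iN iN')[-> _]] := uniq j (cell (sigma f) (i' - i)) _
    j' (cell (sigma f') 0) _ _ Ay _ Az.
  - by exists (f, (i' - i)%N) => //; split=> //=; lia.
  - by exists (f', 0%N) => //; split=> //=; lia.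
  - by rewrite !cell_add subnK // add0n addrA [_ + z]addrC subrK.
  - by split=> //; rewrite raddfD /= z0 addr0.
split=> [g|j f _ j' f' _ Ff [y [i [iN Ay ->]]] Ff' [y' [i' [iN' Ay' ->]]] E].
  have N_gt0 : (0 < N)%N by [].
  have [j [_ [a [[[f i] [/= Ff iN] <-] Aa E]]]] := ex (cell (sigma g) N.-1).
  have [y [i' [iN' aE]]] := cell_ex a.
  exists j, f, (pi y); split=> //; first by exists y, i'; rewrite -aE.
  have /cell_inj[||gE _] : cell (sigma g) (N.-1 - i) = cell (sigma f + y) i'.
  - apply: (addIr (e *+ i)); rewrite !cellM subnK; last by lia.
    by rewrite E aE cell_add addnC.
  - by lia.
  - by [].
  by rewrite -[g]sigmaK gE raddfD /= sigmaK.
have [le_i|/ltnW le_i] := leqP i i'.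
  exact: (aligned j f y i j' f' y' i').
have [-> -> //] :=
  aligned j' f' y' i' j f y i Ff' iN' Ay' Ff iN Ay (esym E) le_i.
Qed.

(** If H is a group of periods of A, then the image under pi of its preimage by
    phi is a group of periods of the descent; its index is finite because the
    coset of [pi y] is determined by the coset of [phi y] modulo H, and every
    element of Gamma is some [pi y]. *)
Lemma descent_periodic A : periodic A -> periodic (descent A).
Proof.
move=> [H [/subgroupP[H0 HB] fin inv]].
pose H' : set Gamma := pi @` [set y | H (phi y)].
have H'0 : H' 0 by exists 0; rewrite /= ?raddf0.
have H'B g g' : H' g -> H' g' -> H' (g - g').
  move=> [y Hy <-] [y' Hy' <-]; exists (y - y'); rewrite /= raddfB //.
  exact: HB.
exists H'; split; first by apply/subgroupP.
  apply: (@sub_finite_set _ _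
    ((fun C => pi @` [set y | C (phi y)]) @`
      [set translate H x | x in [set: G]])).
    move=> _ [g _ <-]; exists (translate H (phi (sigma g))).
      by exists (phi (sigma g)).
    apply/seteqP; split=> [_ [y [h Hh hE] <-]|_ [_ [y Hy <-] <-]].
      exists (pi (y - sigma g)); last by rewrite raddfB /= sigmaK subrK.
      by exists (y - sigma g) => //=; rewrite raddfB /= -hE addrK.
    exists (y + sigma g); last by rewrite raddfD /= sigmaK.
    by exists (phi y) => //; rewrite raddfD.
  exact: finite_image.
have stab g j a : H' g -> descent A j a -> descent A j (a + g).
  move=> [z Hz <-] [y [i [iN Ay ->]]]; exists (y + z), i; split=> //.
    by rewrite cellD -(inv _ Hz); exists (cell y i).
  by rewrite raddfD.
move=> g Hg j; apply/seteqP; split=> [_ [a Aa <-]|a Aa]; first exact: stab.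
exists (a - g); last by rewrite subrK.
by apply: stab => //; rewrite -sub0r; apply: H'B.
Qed.

Lemma tile_finite j : finite_set (F j) -> finite_set (tile j).
Proof.
move=> finF; apply: finite_image.
apply: (@sub_finite_set _ _ (F j `*` `I_N)); first by move=> x.
exact: finite_setX.
Qed.

Theorem tile_aperiodic : aperiodic F -> aperiodic tile.
Proof.
move=> [finF [A /TileP tA] noper]; split=> [j||[B [/TileP tB perB]]].
- exact: tile_finite.
- by exists (lift A); apply/TileP; exact: tiling_lift.
- have inv := tiling_kernel_invariant tB.
  apply: noper; exists (descent B); split; last exact: descent_periodic.
  by apply/TileP; apply: tiling_descent => //; apply/tiling_tile_block.
Qed.

End Simulation.

(** * Segments in Z^d *)

Section Stretch.
Variables (d : nat) (i0 : 'I_d) (N : nat).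
Definition stretch (x : 'rV[int]_d) : 'rV[int]_d :=
  \row_j (x 0 j *+ (if j == i0 then N else 1)).
Lemma stretch_is_additive : zmod_morphism stretch.
Proof. by move=> x y; apply/rowP => j; rewrite !mxE mulrnBl. Qed.
HB.instance Definition _ :=
  GRing.isZmodMorphism.Build _ _ stretch stretch_is_additive.

Local Notation e := (delta_mx 0 i0 : 'rV[int]_d).

Lemma stretch_cellE y n j : cell stretch e y n 0 j =
  if j == i0 then y 0 j * N%:Z + n%:Z else y 0 j.
Proof.
rewrite /cell !mxE mulmxnE mxE eqxx /=; case: eqP => _ /=.
  by rewrite mulr1n natz -mulr_natr natz.
by rewrite mulr0n mul0rn mulr1n addr0.
Qed.

Lemma stretch_cell_ex x : (0 < N)%N ->
  exists y n, (n < N)%N /\ x = cell stretch e y n.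
Proof.
move=> N_gt0; exists (\row_j (if j == i0 then divz (x 0 j) N%:Z else x 0 j)).
exists (absz (modz (x 0 i0) N%:Z)); split; first by lia.
apply/rowP => j; rewrite stretch_cellE !mxE; case: eqP => // ->.
by lia.
Qed.

Lemma stretch_cell_inj y y' n n' : (n < N)%N -> (n' < N)%N ->
  cell stretch e y n = cell stretch e y' n' -> y = y' /\ n = n'.
Proof.
move=> nN nN' E; have {}E j : cell stretch e y n 0 j = cell stretch e y' n' 0 j.
  by rewrite E.
have eq0 : y 0 i0 = y' 0 i0 /\ n = n'.
  have := E i0; rewrite !stretch_cellE eqxx.
  move: (y 0 i0) (y' 0 i0) => a a' eq_a.
  have [lt_a|[eq_aa|gt_a]] : a + 1 <= a' \/ a = a' \/ a' + 1 <= a by lia.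
  - by exfalso; nia.
  - by subst a'; split=> //; lia.
  - by exfalso; nia.
split; last exact: eq0.2.
apply/rowP => j; have := E j; rewrite !stretch_cellE.
by case: eqP => // ->; rewrite eq0.1.
Qed.
End Stretch.

(** * Aperiodic tuples lift along quotients of Z^d *)

Theorem corollary1p2 (d k : nat) (d_gt0 : (0 < d)%N) (k_gt0 : (0 < k)%N)
  (Gamma : zmodType) (pi : {additive 'rV[int]_d -> Gamma})
  (pi_surj : set_surj [set: 'rV[int]_d] [set: Gamma] pi) :
  (exists F : 'I_k -> set Gamma, aperiodic F) ->
  exists F : 'I_k -> set 'rV[int]_d, aperiodic F.
Proof.
move=> [F apF].
have /choice[sigma sigmaK] : forall g, exists x, pi x = g.
  by move=> g; have [x _ <-] := pi_surj g I; exists x.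
have /choice[f0 f0P] : forall j, exists f, forall f', F j f' -> F j f.
  move=> j; have [[f Ff]|none] := pselect (exists f, F j f); first by exists f.
  by exists 0 => f' Ff'; case: none; exists f'.
have [s [s_ker s_gen]] : exists s, monoid_generated [set x | pi x = 0] s.
  apply: lattice_subgroup_generated; apply/subgroupP; split=> [|x y] /=.
    exact: raddf0.
  by move=> x0 y0; rewrite raddfB /= x0 y0 subrr.
pose v (l : 'I_(size s)) := nth 0 s l.
have vs l : v l \in s by apply: mem_nth.
have v_ker l : pi (v l) = 0 by have [] := s_ker _ (vs l).
have v_neq0 l : v l <> 0 by have [] := s_ker _ (vs l).
have v_gen (P : set 'rV[int]_d) : P 0 -> (forall x l, P x -> P (x + v l)) ->
    forall x, pi x = 0 -> P x.
  move=> P0 PS; apply: s_gen => // x w /(nthP 0)[n ns <-].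
  exact: (PS x (Ordinal ns)).
have N_gt0 : (0 < segment_length k (size s))%N by [].
set N := segment_length k (size s) in N_gt0.
pose i0 := Ordinal d_gt0.
exists (tile sigma v F f0 (stretch i0 N) (delta_mx 0 i0)).
apply: (tile_aperiodic sigmaK v_ker v_neq0 v_gen f0P _ _ apF).
- by move=> x; exact: (stretch_cell_ex i0 x N_gt0).
- by move=> y y' n n' nN nN'; exact: (stretch_cell_inj nN nN').
Qed.
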